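(* 1. Let $\epsilon$ be a valuation, $\mathbf p$ an expectation lower bound (a function from valuations to $[0,1]$), $s$ a pGCL program, $l$ a logical variable, and $\varphi$ a pDL formula with no free logical variable other than possibly $l$. If $\epsilon\models[s]_{\mathbf p}\,(\forall l\cdot\varphi)$, then $\epsilon\models\forall l\cdot[s]_{\mathbf p}\,\varphi$. The converse fails in general: there exist a valuation $\epsilon$, an expectation lower bound $\mathbf p$, a pGCL program $s$, a logical variable $l$ (with some domain $\mathrm{dom}\,l$) and a pDL formula $\varphi$ with no free logical variable other than possibly $l$ such that $\epsilon\models\forall l\cdot[s]_{\mathbf p}\,\varphi$ but not $\epsilon\models[s]_{\mathbf p}\,(\forall l\cdot\varphi)$. 2. Let $\epsilon$ be a valuation, $\mathbf p$ an expectation lower bound (a function from valuations to $[0,1]$), $s$ a pGCL program, $l$ a logical variable, and $\varphi$ a pDL formula with no free logical variable other than possibly $l$. If $\epsilon\models\exists l\cdot[s]_{\mathbf p}\,\varphi$, then $\epsilon\models[s]_{\mathbf p}\,(\exists l\cdot\varphi)$. The converse fails in general: there exist a valuation $\epsilon$, an expectation lower bound $\mathbf p$, a pGCL program $s$, a logical variable $l$ (with some domain $\mathrm{dom}\,l$) and a pDL formula $\varphi$ with no free logical variable other than possibly $l$ such that $\epsilon\models[s]_{\mathbf p}\,(\exists l\cdot\varphi)$ but not $\epsilon\models\exists l\cdot[s]_{\mathbf p}\,\varphi$.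
   Context: **Programs (pGCL).** Fix a set $X$ of program variables. Expressions $e$ are built from program variables and primitive values (Booleans, numbers, ...) with the usual unary/binary arithmetic, comparison and logical operators; they are assumed well-formed, and $\epsilon(e)$ denotes the value of $e$ in a valuation $\epsilon$ (a map from program variables to values). Programs are $$s ::= s\sqcap s \mid s\,{}_{e}\!\oplus s\mid s;s\mid \mathtt{skip}\mid x:=e\mid \mathtt{if}\ e\ \{s\}\ \mathtt{else}\ \{s\}\mid\mathtt{while}\ e\ \{s\},$$ where $\sqcap$ is demonic (non-deterministic) choice and ${}_e\oplus$ is probabilistic choice (left branch with probability given by the value of $e$). **MDP semantics.** A program $s$ denotes a Markov decision process $\mathcal M_s$ with states $\langle\epsilon,s'\rangle$ (valuation, program). A positional policy $\pi$ maps states to available actions; the only states with more than one action are those where a demonic choice is to be resolved, and $\pi\langle\epsilon,s_1\sqcap s_2\rangle\in\{s_1,s_2\}$. For a policy $\pi$, the probabilistic transitions $\sigma\xrightarrow{p}_\pi\sigma'$ are given by the rules: - $\langle\epsilon,x:=e\rangle\xrightarrow{1}_\pi\langle\epsilon[x\mapsto\epsilon(e)],\mathtt{skip}\rangle$; - if $\epsilon(e)=p\in[0,1]$: $\langle\epsilon,s_1\,{}_e\!\oplus s_2\rangle\xrightarrow{p}_\pi\langle\epsilon,s_1\rangle$ and $\langle\epsilon,s_1\,{}_e\!\oplus s_2\rangle\xrightarrow{1-p}_\pi\langle\epsilon,s_2\rangle$ (probabilities are added if the targets coincide); - if $\pi\langle\epsilon,s_1\sqcap s_2\rangle=s_i$: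 $\langle\epsilon,s_1\sqcap s_2\rangle\xrightarrow{1}_\pi\langle\epsilon,s_i\rangle$; - if $\langle\epsilon,s_1\rangle\xrightarrow{p}_\pi\langle\epsilon',s_2\rangle$: $\langle\epsilon,\mathtt{skip};s_1\rangle\xrightarrow{p}_\pi\langle\epsilon',s_2\rangle$ and $\langle\epsilon,s_1;s\rangle\xrightarrow{p}_\pi\langle\epsilon',s_2;s\rangle$; - $\langle\epsilon,\mathtt{if}\ e\ \{s_1\}\ \mathtt{else}\ \{s_2\}\rangle\xrightarrow{1}_\pi\langle\epsilon,s_1\rangle$ if $\epsilon(e)=\mathit{true}$, and $\xrightarrow{1}_\pi\langle\epsilon,s_2\rangle$ if $\epsilon(e)=\mathit{false}$; - $\langle\epsilon,\mathtt{while}\ e\ \{s\}\rangle\xrightarrow{1}_\pi\langle\epsilon,s;\mathtt{while}\ e\ \{s\}\rangle$ if $\epsilon(e)=\mathit{true}$, and $\xrightarrow{1}_\pi\langle\epsilon,\mathtt{skip}\rangle$ if $\epsilon(e)=\mathit{false}$. A state is final if it has no transitions; the state $\langle\epsilon,\mathtt{skip}\rangle$ is final. Standing assumption: every program considered (every program occurring inside a box) reaches, from every initial valuation and under every policy, a state of the form $\langle\epsilon',\mathtt{skip}\rangle$ with probability $1$. **Expectations.** A path is a finite sequence of states $\sigma_1,\dots,\sigma_n$ with consecutive positive-probability transitions under $\pi$ ending in a final state $\mathrm{final}(\overline\sigma)=\sigma_n$; $\Pr(\overline\sigma)$ is the product of its transition probabilities (equal to $1$ for a one-state path), and $\mathrm{paths}_\pi(\sigma)$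 is the set of paths from $\sigma$. For a reward $r$ with values in $[0,1]$ on final states, $$\mathbb E_{\sigma,\pi}\,r=\sum_{\overline\sigma\in\mathrm{paths}_\pi(\sigma)}\Pr(\overline\sigma)\,r(\mathrm{final}(\overline\sigma)),\qquad \mathbf E_\sigma\,r=\inf_\pi\mathbb E_{\sigma,\pi}\,r .$$ A function of valuations is regarded as a reward by evaluating it on the valuation of the final state. **Logic (pDL).** Let $L$ be a set of logical variables disjoint from $X$; each $l\in L$ has a domain $\mathrm{dom}\,l$ of values. Formulae are $$\varphi::=\text{atomic formula}\mid\neg\varphi\mid\varphi_1\wedge\varphi_2\mid\forall l\cdot\varphi\mid[s]_{\mathbf p}\,\varphi,$$ where atomic formulae are built from constants, program variables and logical variables (they include equalities such as $x=l$ with $x\in X$, $l\in L$), $s$ is a pGCL program (it mentions no logical variables), and $\mathbf p$ is an expectation lower bound, i.e. a function from valuations of program variables to $[0,1]$ (not depending on logical variables, so $([s]_{\mathbf p}\varphi)[l:=v]$ is $[s]_{\mathbf p}(\varphi[l:=v])$). $\to,\vee,\exists$ are derived as usual ($\exists l\cdot\varphi$ is $\neg\forall l\cdot\neg\varphi$). Satisfaction $\epsilon\models\varphi$ for formulae without free logical variables is defined by: standard satisfaction for atomic formulae; the classical clauses for $\neg,\wedge$; $\epsilon\models\forall l\cdot\varphi$ iff $\epsilon\models\varphi[l:=v]$ for each $v\in\mathrm{dom}\,l$; and $$\epsilon\models[s]_{\mathbf p}\,\varphi\quad\text{iff}\quad \mathbf p(\epsilon)\le\mathbf E_{\langle\epsilon,s\rangle}[\![\varphi]\!]\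 \text{ in }\mathcal M_s,$$ where $[\![\varphi]\!](\epsilon')=1$ if $\epsilon'\models\varphi$ and $0$ otherwise. *)

(* Defs.v *)
From HB Require Import structures.
From mathcomp Require Import all_boot all_order all_algebra.
From mathcomp Require Import boolp classical_sets.
From mathcomp Require Import interval_inference reals constructive_ereal ereal.
From mathcomp Require Import numfun esum.

Set Implicit Arguments.
Unset Strict Implicit.
Unset Printing Implicit Defensive.

Import Order.TTheory GRing.Theory Num.Theory.

Local Open Scope classical_set_scope.
Local Open Scope ring_scope.

(* Well-formedness of expressions is well-typedness, enforced by indexing
   variables, values and expressions with a type. *)
Inductive ty : Type := TBool | TNum.

Definition value (R : realType) (t : ty) : eqType :=
  match t with TBool => bool | TNum => R end.

Inductive arith_op : Type := OpAdd | OpSub | OpMul | OpDiv.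
Inductive cmp_op : Type := OpLe | OpLt.
Inductive logic_op : Type := OpAnd | OpOr.

Section Expressions.
Variables (R : realType) (V : Type) (vty : V -> ty).

Inductive expr : ty -> Type :=
| EVar (x : V) : expr (vty x)
| EConst (t : ty) (c : value R t) : expr t
| EOpp (e : expr TNum) : expr TNum
| ENot (e : expr TBool) : expr TBool
| EArith (o : arith_op) (e1 e2 : expr TNum) : expr TNum
| ECmp (o : cmp_op) (e1 e2 : expr TNum) : expr TBool
| ELogic (o : logic_op) (e1 e2 : expr TBool) : expr TBool
| EEq (t : ty) (e1 e2 : expr t) : expr TBool.

(* Division by zero yields 0, as everywhere in the library. *)
Definition eval_arith (o : arith_op) (a b : R) : R :=
  match o with
  | OpAdd => a + b | OpSub => a - b | OpMul => a * b | OpDiv => a / b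
  end.

Definition eval_cmp (o : cmp_op) (a b : R) : bool :=
  match o with OpLe => a <= b | OpLt => a < b end.

Definition eval_logic (o : logic_op) (a b : bool) : bool :=
  match o with OpAnd => a && b | OpOr => a || b end.

Fixpoint eval_expr (env : forall x : V, value R (vty x)) (t : ty) (e : expr t) :
    value R t :=
  match e in expr t return value R t with
  | EVar x => env x
  | EConst _ c => c
  | EOpp e => - (eval_expr env e : R)
  | ENot e => ~~ (eval_expr env e : bool)
  | EArith o e1 e2 => eval_arith o (eval_expr env e1) (eval_expr env e2)
  | ECmp o e1 e2 => eval_cmp o (eval_expr env e1) (eval_expr env e2)
  | ELogic o e1 e2 => eval_logic o (eval_expr env e1) (eval_expr env e2)
  | EEq _ e1 e2 => eval_expr env e1 == eval_expr env e2
  end.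

Fixpoint occurs (y : V) (t : ty) (e : expr t) : Prop :=
  match e with
  | EVar x => y = x
  | EConst _ _ => False
  | EOpp e => occurs y e
  | ENot e => occurs y e
  | EArith _ e1 e2 => occurs y e1 \/ occurs y e2
  | ECmp _ e1 e2 => occurs y e1 \/ occurs y e2
  | ELogic _ e1 e2 => occurs y e1 \/ occurs y e2
  | EEq _ e1 e2 => occurs y e1 \/ occurs y e2
  end.

Fixpoint esubst (th : forall x : V, expr (vty x)) (t : ty) (e : expr t) :
    expr t :=
  match e in expr t return expr t with
  | EVar x => th x
  | EConst _ c => EConst c
  | EOpp e => EOpp (esubst th e)
  | ENot e => ENot (esubst th e)
  | EArith o e1 e2 => EArith o (esubst th e1) (esubst th e2)
  | ECmp o e1 e2 => ECmp o (esubst th e1) (esubst th e2)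
  | ELogic o e1 e2 => ELogic o (esubst th e1) (esubst th e2)
  | EEq _ e1 e2 => EEq (esubst th e1) (esubst th e2)
  end.

End Expressions.

Arguments EVar {R V vty} x.
Arguments EConst {R V vty t} c.
Arguments eval_expr {R V vty} env {t} e.

Section Programs.
Variables (R : realType) (X : eqType) (xty : X -> ty).

Definition valuation : Type := forall x : X, value R (xty x).

Inductive prog : Type :=
| Demonic (s1 s2 : prog)
| Prob (e : expr R xty TNum) (s1 s2 : prog)
| Seq (s1 s2 : prog)
| Skip
| Assign (x : X) (e : expr R xty (xty x))
| If (e : expr R xty TBool) (s1 s2 : prog)
| While (e : expr R xty TBool) (s : prog).

HB.instance Definition _ := gen_eqMixin valuation.
HB.instance Definition _ := gen_choiceMixin valuation.
HB.instance Definition _ := gen_eqMixin prog.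
HB.instance Definition _ := gen_choiceMixin prog.

Definition state : Type := (valuation * prog)%type.

HB.instance Definition _ := Choice.on state.

(* Only the value of a policy on the states (eps, Demonic s1 s2) matters; all
   other states have a single action. *)
Record policy : Type := Policy {
  act :> state -> prog ;
  actP : forall eps s1 s2,
    act (eps, Demonic s1 s2) = s1 \/ act (eps, Demonic s1 s2) = s2 }.

(* [tprob pi eps s sg] is the probability of the transition from (eps, s) to sg
   under pi, and 0 if there is none. As Skip has no transition, the two rules
   for sequential composition never apply to the same state; in particular
   (eps, Seq Skip Skip) has no transition. *)
Fixpoint tprob (pi : policy) (eps : valuation) (s : prog) (sg : state) : R :=
  match s with
  | Demonic s1 s2 => (sg == (eps, pi (eps, Demonic s1 s2)))%:R
  | Prob e s1 s2 =>
      let p : R := eval_expr eps e in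
      if 0 <= p <= 1 then
        p * (sg == (eps, s1))%:R + (1 - p) * (sg == (eps, s2))%:R
      else 0
  | Seq Skip s2 => tprob pi eps s2 sg
  | Seq s1 s2 =>
      if sg.2 is Seq s1' s2' then
        if s2' == s2 then tprob pi eps s1 (sg.1, s1') else 0
      else 0
  | Skip => 0
  | Assign x e => (sg == (dfwith eps (eval_expr eps e) : valuation, Skip))%:R
  | If e s1 s2 => (sg == (eps, if eval_expr eps e then s1 else s2))%:R
  | While e s1 =>
      (sg == (eps, if eval_expr eps e then Seq s1 (While e s1) else Skip))%:R
  end.

Definition trans (pi : policy) (sg sg' : state) : R :=
  tprob pi sg.1 sg.2 sg'.

Definition final (pi : policy) (sg : state) : Prop :=
  forall sg', trans pi sg sg' = 0.

(* A path sg_1, ..., sg_n from sg = sg_1 is represented by its tail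
   sg_2, ..., sg_n; its last state is [last sg t]. *)
Definition paths (pi : policy) (sg : state) : set (seq state) :=
  [set t | path (fun a b => 0 < trans pi a b) sg t /\ final pi (last sg t)].

Fixpoint path_prob (pi : policy) (sg : state) (t : seq state) : R :=
  if t is sg' :: t' then trans pi sg sg' * path_prob pi sg' t' else 1.

Definition expect_policy (pi : policy) (sg : state) (r : state -> R) : \bar R :=
  (\esum_(t in paths pi sg) (path_prob pi sg t * r (last sg t))%:E)%E.

Definition expect (sg : state) (r : state -> R) : \bar R :=
  ereal_inf [set expect_policy pi sg r | pi in [set: policy]].

Definition terminates (s : prog) : Prop :=
  forall (eps : valuation) (pi : policy),
    expect_policy pi (eps, s) \1_[set sg : state | sg.2 = Skip] = 1%E.

End Programs.

Arguments Skip {R X xty}.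

Section Logic.
Variables (R : realType) (X : eqType) (xty : X -> ty).
Variables (L : eqType) (lty : L -> ty).

Definition var_ty (y : X + L) : ty :=
  match y with inl x => xty x | inr l => lty l end.

Inductive formula : Type :=
| Atom (e : expr R var_ty TBool)
| Not (phi : formula)
| And (phi psi : formula)
| Forall (l : L) (phi : formula)
| Box (s : prog R xty) (p : valuation R xty -> {i01 R}) (phi : formula).

Definition Exists (l : L) (phi : formula) : formula :=
  Not (Forall l (Not phi)).

Fixpoint free_in (l : L) (phi : formula) : Prop :=
  match phi with
  | Atom e => occurs (inr l) e
  | Not phi => free_in l phi
  | And phi psi => free_in l phi \/ free_in l psi
  | Forall l' phi => l <> l' /\ free_in l phi
  | Box _ _ phi => free_in l phi
  end.

Fixpoint boxes_terminate (phi : formula) : Prop :=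
  match phi with
  | Atom _ => True
  | Not phi => boxes_terminate phi
  | And phi psi => boxes_terminate phi /\ boxes_terminate psi
  | Forall _ phi => boxes_terminate phi
  | Box s _ phi => terminates s /\ boxes_terminate phi
  end.

Definition subst_var (l : L) (v : value R (lty l)) (y : X + L) :
    expr R var_ty (var_ty y) :=
  match y with
  | inl x => EVar (inl x : X + L)
  | inr l' =>
      @dfwith L (fun k => expr R var_ty (lty k))
        (fun k => EVar (inr k : X + L)) l (EConst v) l'
  end.

Fixpoint subst (l : L) (v : value R (lty l)) (phi : formula) : formula :=
  match phi with
  | Atom e => Atom (esubst (subst_var v) e)
  | Not phi => Not (subst v phi)
  | And phi psi => And (subst v phi) (subst v psi)
  | Forall l' phi => Forall l' (if l' == l then phi else subst v phi)
  | Box s p phi => Box s p (subst v phi)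
  end.

(* Satisfaction is only meaningful for formulae without free logical variables;
   a free logical variable gets an arbitrary value. *)
Definition default_value (t : ty) : value R t :=
  match t return value R t with TBool => false | TNum => (0 : R) end.

Definition atom_env (eps : valuation R xty) (y : X + L) :
    value R (var_ty y) :=
  match y return value R (var_ty y) with
  | inl x => eps x
  | inr l => default_value (lty l)
  end.

Variable dom : forall l : L, set (value R (lty l)).

Fixpoint depth (phi : formula) : nat :=
  match phi with
  | Atom _ => 1
  | Not phi => (depth phi).+1
  | And phi psi => (maxn (depth phi) (depth psi)).+1
  | Forall _ phi => (depth phi).+1
  | Box _ _ phi => (depth phi).+1
  end.

(* The clause for Forall recurses on a substitution instance, so the recursion
   is on a bound on the depth; the intended clauses are the lemmas satA, satN,
   satI, satF and satB below. *)
Fixpoint sat_rec (n : nat) (eps : valuation R xty) (phi : formula) : Prop :=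
  if n isn't n'.+1 then False else
  match phi with
  | Atom e => eval_expr (atom_env eps) e = true
  | Not phi => ~ sat_rec n' eps phi
  | And phi psi => sat_rec n' eps phi /\ sat_rec n' eps psi
  | Forall l phi => forall v, dom v -> sat_rec n' eps (subst (l := l) v phi)
  | Box s p phi =>
      ((p eps)%:num%:E <=
       expect (eps, s) (fun sg => \1_[set eps' | sat_rec n' eps' phi] sg.1))%E
  end.

Definition sat (eps : valuation R xty) (phi : formula) : Prop :=
  sat_rec (depth phi) eps phi.

Definition sem (phi : formula) : valuation R xty -> R :=
  \1_[set eps | sat eps phi].

Lemma depth_subst (l : L) (v : value R (lty l)) (phi : formula) :
  depth (subst v phi) = depth phi.
Proof.
elim: phi => //= [? ->|? -> ? ->|l' phi IH|? ? ? ->] //.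
by case: ifP; rewrite ?IH.
Qed.

Lemma sat_recE (n : nat) (eps : valuation R xty) (phi : formula) :
  (depth phi <= n)%N -> sat_rec n eps phi = sat eps phi.
Proof.
suff H m : forall k phi eps, (depth phi <= m)%N -> (depth phi <= k)%N ->
    sat_rec m eps phi = sat_rec k eps phi by move=> ?; exact: H.
elim: m => [|m IH] [|k] [e|psi|psi1 psi2|l psi|s p psi] {}eps //=;
  rewrite !ltnS.
- by move=> hm hk; rewrite (IH k).
- rewrite !geq_max => /andP[? ?] /andP[? ?].
  by rewrite (IH k psi1) // (IH k psi2).
- move=> hm hk; apply: eq_forall => v.
  by rewrite (IH k) ?depth_subst.
- move=> hm hk.
  suff -> : [set eps' | sat_rec m eps' psi] = [set eps' | sat_rec k eps' psi]
    by [].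
  by apply/seteqP; split=> eps' /=; rewrite (IH k).
Qed.

Lemma satA eps e : sat eps (Atom e) = (eval_expr (atom_env eps) e = true).
Proof. by []. Qed.

Lemma satN eps phi : sat eps (Not phi) = ~ sat eps phi.
Proof. by []. Qed.

Lemma satI eps phi psi : sat eps (And phi psi) = (sat eps phi /\ sat eps psi).
Proof. by rewrite /sat /= !sat_recE // ?leq_maxl ?leq_maxr. Qed.

Lemma satF eps l phi :
  sat eps (Forall l phi) = forall v, dom v -> sat eps (subst (l := l) v phi).
Proof.
by rewrite {1}/sat /=; apply: eq_forall => v; rewrite sat_recE ?depth_subst.
Qed.

Lemma satB eps s p phi :
  sat eps (Box s p phi) =
  ((p eps)%:num%:E <= expect (eps, s) (fun sg => sem phi sg.1))%E.
Proof. by []. Qed.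

End Logic.

(* Main.v *)
(** Satisfaction of [s]_p phi is monotone in phi, because path probabilities are
    nonnegative and an infimum of monotone functionals is monotone; both
    implications follow from this.

    For both converses, start with x = d and let s set x to some d' <> d with
    probability 1/2 and do nothing otherwise. Let phi say that x = d iff
    l = d0, where d0 and some other value both lie in dom l. Whatever the value
    of l, phi holds after s with probability exactly 1/2; but every final
    valuation violates phi for some l and satisfies it for another, so that
    forall l, phi has probability 0 and exists l, phi has probability 1. The
    bounds p = 1/2 and p = 1 refute the respective converses. *)

Require Import Defs.
From mathcomp Require Import all_boot.
From mathcomp Require Import classical_sets interval_inference reals.
From mathcomp Require Import all_order all_algebra.
From mathcomp Require Import boolp cardinality fsbigop.
From mathcomp Require Import constructive_ereal ereal numfun esum lra.

Set Implicit Arguments.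
Unset Strict Implicit.
Unset Printing Implicit Defensive.

Import Order.TTheory GRing.Theory Num.Theory.

Local Open Scope classical_set_scope.
Local Open Scope ring_scope.

(** * Monotonicity of expectations and of the box in its postcondition *)

Lemma indic_le (R : realType) (T : Type) (A B : set T) (x : T) :
  A `<=` B -> (\1_A x : R) <= \1_B x.
Proof.
move=> AB; rewrite !indicE ler_nat.
by have [/set_mem/AB/mem_set ->|] := boolP (x \in A).
Qed.

Section Monotonicity.
Variables (R : realType) (X : eqType) (xty : X -> ty).
Implicit Types (pi : policy R xty) (sg : state R xty) (r : state R xty -> R).

Lemma path_prob_ge0 pi sg t :
  path (fun a b => 0 < trans pi a b) sg t -> 0 <= path_prob pi sg t.
Proof.
by elim: t sg => //= sg' t IH sg /andP[/ltW? /IH?]; exact: mulr_ge0.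
Qed.

Lemma le_expect sg r1 r2 :
  (forall sg', r1 sg' <= r2 sg') -> (expect sg r1 <= expect sg r2)%E.
Proof.
move=> r12; apply: le_ereal_inf_tmp => _ [pi _ <-].
(* The infimum for [r1] is at most the value of [r1] under the same policy [pi]. *)
apply: le_trans (ereal_inf_lbound _) _; first by exists pi.
apply: le_esum => t [/path_prob_ge0 ? _].
by rewrite lee_fin ler_wpM2l.
Qed.

Lemma sat_box_mono (L : eqType) (lty : L -> ty)
    (dom : forall l : L, set (value R (lty l)))
    (s : prog R xty) p (phi psi : formula R xty lty) eps :
  (forall eps', sat dom eps' phi -> sat dom eps' psi) ->
  sat dom eps (Box s p phi) -> sat dom eps (Box s p psi).
Proof.
move=> phipsi; rewrite !satB => /le_trans; apply; apply: le_expect => sg.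
exact: indic_le.
Qed.

End Monotonicity.

(** * A fair coin flip between stopping and assigning a constant *)

Section FairAssignment.
Variables (R : realType) (X : eqType) (xty : X -> ty).
Implicit Types (pi : policy R xty) (eps : valuation R xty).
Implicit Types (r : state R xty -> R).

(** Witnesses that a policy exists; over no policies the infimum in [expect] would be [+oo]. *)
Definition first_choice (sg : state R xty) : prog R xty :=
  if sg.2 is Demonic s1 _ then s1 else Skip.

Lemma first_choiceP eps s1 s2 :
  first_choice (eps, Demonic s1 s2) = s1 \/
  first_choice (eps, Demonic s1 s2) = s2.
Proof. by left. Qed.

Variables (x : X) (c : value R (xty x)).

Definition fair_assign : prog R xty :=
  Prob (EConst (t := TNum) (2^-1 : R)) Skip (Assign (EConst c)).

Definition update eps : valuation R xty := dfwith eps c.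

Lemma update_same eps : update eps x = c.
Proof. exact: dfwith_in. Qed.

Lemma trans_fair_assign pi eps sg :
  trans pi (eps, fair_assign) sg =
  2^-1 * ((sg == (eps, Skip))%:R + (sg == (eps, Assign (EConst c)))%:R).
Proof. rewrite /trans /= ifT; [lra | apply/andP; split; lra]. Qed.

(** The two targets of the coin flip differ as programs, even if [x] already has the value [c], so
    their probabilities are never added up. *)
Lemma neq_skip_assign eps :
  ((eps, Skip) == (eps, Assign (EConst c)) :> state R xty) = false.
Proof. by apply/eqP => -[]. Qed.

Lemma trans_fair_assign_skip pi eps :
  trans pi (eps, fair_assign) (eps, Skip) = 2^-1.
Proof. by rewrite trans_fair_assign eqxx neq_skip_assign addr0 mulr1. Qed.

Lemma trans_fair_assign_assign pi eps :
  trans pi (eps, fair_assign) (eps, Assign (EConst c)) = 2^-1.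
Proof.
by rewrite trans_fair_assign eqxx eq_sym neq_skip_assign add0r mulr1.
Qed.

Lemma trans_assign pi eps sg :
  trans pi (eps, Assign (EConst c)) sg = (sg == (update eps, Skip))%:R.
Proof. by []. Qed.

(** A path is stored without its first state, so the one-state path is the empty list. *)
Lemma paths_skip pi eps : paths pi (eps, Skip) = [set [::]].
Proof.
apply/seteqP; split=> [[|sg t] [] //=|_ ->]; last by split.
by rewrite /trans /= ltxx.
Qed.

Lemma paths_assign pi eps :
  paths pi (eps, Assign (EConst c)) = [set [:: (update eps, Skip)]].
Proof.
apply/seteqP; split=> [[|sg t] []|_ ->]; last first.
- by split=> //=; rewrite trans_assign eqxx ltr01.
- rewrite [path _ _ _]/= trans_assign; case: eqP => [->|_]; last by rewrite ltxx.
  move=> /andP[_ tp] tf.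
  have : paths pi (update eps, Skip) t by split.
  by rewrite paths_skip => ->.
(* The empty tail is excluded: a state with an outgoing transition is not final. *)
- move=> _ /(_ (update eps, Skip)) /= /eqP.
  by rewrite trans_assign eqxx oner_eq0.
Qed.

Lemma paths_fair_assign pi eps :
  paths pi (eps, fair_assign) =
  [set [:: (eps, Skip)]] `|`
  [set [:: (eps, Assign (EConst c)); (update eps, Skip)]].
Proof.
have half_gt0 : 0 < 2^-1 :> R by rewrite invr_gt0.
apply/seteqP; split=> [[|sg t] []|_ [] ->].
- move=> _ /(_ (eps, Skip)) /= /eqP.
  by rewrite trans_fair_assign_skip gt_eqF.
- rewrite [path _ _ _]/= trans_fair_assign.
  have [->|_] := eqVneq sg (eps, Skip).
    move=> /andP[_ tp] tf; left.
    have : paths pi (eps, Skip) t by split.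
    by rewrite paths_skip => ->.
  have [->|_] := eqVneq sg (eps, Assign (EConst c)).
    move=> /andP[_ tp] tf; right.
    have : paths pi (eps, Assign (EConst c)) t by split.
    by rewrite paths_assign => ->.
  by rewrite addr0 mulr0 ltxx.
- by split=> //=; rewrite trans_fair_assign_skip half_gt0.
- split=> //=.
  by rewrite trans_fair_assign_assign half_gt0 trans_assign eqxx ltr01.
Qed.

Lemma expect_policy_fair_assign pi eps r : (forall sg, 0 <= r sg) ->
  expect_policy pi (eps, fair_assign) r =
  (2^-1 * (r (eps, Skip) + r (update eps, Skip)))%:E.
Proof.
move=> r0; rewrite /expect_policy paths_fair_assign esum_fset; first last.
- move=> t; rewrite inE => -[] -> /=; rewrite lee_fin mulr_ge0//.
  + by rewrite trans_fair_assign_skip mulr1 invr_ge0.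
  + by rewrite trans_fair_assign_assign trans_assign eqxx !mulr1 invr_ge0.
- by rewrite finite_setU; split; exact: finite_set1.
(* The two tails have different lengths, so the union is disjoint. *)
rewrite fsbigU; [|exact: finite_set1|exact: finite_set1|by move=> t [] ->].
rewrite !fsbig_set1 /= trans_fair_assign_skip trans_fair_assign_assign.
by rewrite trans_assign eqxx !mulr1 -EFinD mulrDr.
Qed.

(** Without demonic choice all policies give the same value, so the infimum is that of a
    constant. *)
Lemma expect_fair_assign eps r : (forall sg, 0 <= r sg) ->
  expect (eps, fair_assign) r =
  (2^-1 * (r (eps, Skip) + r (update eps, Skip)))%:E.
Proof.
move=> r0; rewrite /expect.
under eq_imagel do rewrite expect_policy_fair_assign//.
apply: ereal_inf_cst; by apply/set0P; exists (Policy first_choiceP).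
Qed.

Lemma terminates_fair_assign : terminates fair_assign.
Proof.
move=> eps pi; rewrite expect_policy_fair_assign; last first.
  by move=> sg; rewrite indicE.
by rewrite !indicE !mem_set// -[1 + 1]/(2%:R) mulVf// pnatr_eq0.
Qed.

End FairAssignment.

(** * The formula linking [x] and [l], and its probability after the coin flip *)

Section Counterexample.
Variables (R : realType) (X : eqType) (xty : X -> ty).
Variables (L : eqType) (lty : L -> ty) (x : X) (l : L).

Definition other_value (t : ty) : value R t :=
  match t return value R t with TBool => true | TNum => (1 : R) end.

Lemma other_value_neq (t : ty) : (other_value t == default_value R t) = false.
Proof. by case: t => //=; rewrite oner_eq0. Qed.

(** The types of [x] and [l] may differ, so two Boolean tests are compared instead of [x] and [l]
    themselves; the outer [EEq] acts as a biconditional. *)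
Definition agree : formula R xty lty :=
  Atom (EEq (EEq (EVar (inl x : X + L))
                 (EConst (t := xty x) (default_value R (xty x))))
            (EEq (EVar (inr l : X + L))
                 (EConst (t := lty l) (default_value R (lty l))))).

Definition set_other : prog R xty := fair_assign (other_value (xty x)).

Definition default_valuation : valuation R xty :=
  fun y => default_value R (xty y).

Variable dom : forall k : L, set (value R (lty k)).

Lemma sat_agree eps (v : value R (lty l)) :
  sat dom eps (subst v agree) =
  ((eps x == default_value R (xty x)) == (v == default_value R (lty l))).
Proof.
(* As [l] is abstract, [dfwith] does not compute at [l]; hence this rewrite rule, with [subst_var]
   kept folded. *)
have subst_l : subst_var xty v (inr l) = EConst v by exact: dfwith_in.
by rewrite satA; cbn -[subst_var]; rewrite subst_l.
Qed.

Lemma free_in_agree l' : free_in l' agree -> l' = l.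
Proof. by move=> /= [[]|[[]|]] // []. Qed.

Lemma sat_box_set_other p phi :
  sat dom default_valuation (Box set_other p phi) =
  ((p default_valuation)%:num <=
   2^-1 * (sem dom phi default_valuation +
           sem dom phi (update (other_value (xty x)) default_valuation))).
Proof.
by rewrite satB expect_fair_assign ?lee_fin// => sg; rewrite /sem indicE.
Qed.

Lemma sem_agree_default (v : value R (lty l)) :
  sem dom (subst v agree) default_valuation = (v == default_value R (lty l))%:R.
Proof.
rewrite /sem indicE; congr (_%:R); congr nat_of_bool; apply/idP/idP.
  by rewrite inE /= sat_agree eqxx => /eqP.
by move=> h; rewrite inE /= sat_agree eqxx h.
Qed.

Lemma sem_agree_update (v : value R (lty l)) :
  sem dom (subst v agree) (update (other_value (xty x)) default_valuation) =
  (v != default_value R (lty l))%:R.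
Proof.
rewrite /sem indicE; congr (_%:R); congr nat_of_bool; apply/idP/idP.
  by rewrite inE /= sat_agree update_same other_value_neq => /eqP <-.
by move=> h; rewrite inE /= sat_agree update_same other_value_neq (negbTE h).
Qed.

(** For each [v] exactly one of the two final valuations satisfies the instance, so the indicators
    sum to 1. *)
Lemma sat_box_agree p (v : value R (lty l)) :
  sat dom default_valuation (Box set_other p (subst v agree)) =
  ((p default_valuation)%:num <= 2^-1).
Proof.
rewrite sat_box_set_other sem_agree_default sem_agree_update.
by case: (v == _); rewrite ?addr0 ?add0r mulr1.
Qed.

End Counterexample.

Theorem theorem6 (R : realType) (X : eqType) (xty : X -> ty)
    (L : eqType) (lty : L -> ty) :
  ((forall (dom : forall l : L, set (value R (lty l)))
      (eps : valuation R xty) (p : valuation R xty -> {i01 R})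
      (s : prog R xty) (l : L) (phi : formula R xty lty),
      (forall l', free_in l' phi -> l' = l) ->
      terminates s -> boxes_terminate phi ->
      sat dom eps (Box s p (Forall l phi)) ->
      sat dom eps (Forall l (Box s p phi)))
   /\
   (inhabited X -> inhabited L ->
    exists (dom : forall l : L, set (value R (lty l)))
      (eps : valuation R xty) (p : valuation R xty -> {i01 R})
      (s : prog R xty) (l : L) (phi : formula R xty lty),
      [/\ (forall l', free_in l' phi -> l' = l),
          terminates s,
          boxes_terminate phi,
          sat dom eps (Forall l (Box s p phi)) &
          ~ sat dom eps (Box s p (Forall l phi))]))
  /\
  ((forall (dom : forall l : L, set (value R (lty l)))
      (eps : valuation R xty) (p : valuation R xty -> {i01 R})
      (s : prog R xty) (l : L) (phi : formula R xty lty),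
      (forall l', free_in l' phi -> l' = l) ->
      terminates s -> boxes_terminate phi ->
      sat dom eps (Exists l (Box s p phi)) ->
      sat dom eps (Box s p (Exists l phi)))
   /\
   (inhabited X -> inhabited L ->
    exists (dom : forall l : L, set (value R (lty l)))
      (eps : valuation R xty) (p : valuation R xty -> {i01 R})
      (s : prog R xty) (l : L) (phi : formula R xty lty),
      [/\ (forall l', free_in l' phi -> l' = l),
          terminates s,
          boxes_terminate phi,
          sat dom eps (Box s p (Exists l phi)) &
          ~ sat dom eps (Exists l (Box s p phi))])).
Proof.
split; split.
- move=> dom eps p s l phi _ _ _ sat_all; rewrite satF => v vl.
  by apply: sat_box_mono sat_all => eps'; rewrite satF; apply.
- move=> [x] [l].
  have half0 : 0 <= 2^-1 :> R by lra.
  have half1 : 2^-1 <= 1 :> R by lra.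
  exists (fun=> setT), (@default_valuation R X xty).
  exists (fun=> Itv01 half0 half1), (set_other R xty x), l, (agree R xty lty x l).
  split=> //; first exact: free_in_agree.
  + exact: terminates_fair_assign.
  + by rewrite satF => v _; rewrite sat_box_agree.
  (* The updated valuation falsifies the instance at the default value of [l], the initial one that
     at [other_value]. Both indicators vanish, and [1/2 <= 0] is absurd. *)
  rewrite sat_box_set_other /sem !indicE !memNset /=; first by lra.
  + rewrite satF => /(_ (default_value R (lty l)) Logic.I).
    by rewrite sat_agree update_same other_value_neq eqxx.
  + rewrite satF => /(_ (other_value R (lty l)) Logic.I).
    by rewrite sat_agree other_value_neq eqxx.
- move=> dom eps p s l phi _ _ _; rewrite /Exists satN satF => sat_ex.
  (* [Exists] abbreviates a negated [Forall] and yields no witness directly; if the goal failed, no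
     [v] could satisfy the box. *)
  apply: contrapT => nsat; apply: sat_ex => v vl; rewrite satN => sat_v.
  apply: nsat; apply: sat_box_mono sat_v => eps' sat_v.
  by rewrite satN satF => /(_ v vl).
- move=> [x] [l].
  exists (fun=> setT), (@default_valuation R X xty), (fun=> 1%:i01).
  exists (set_other R xty x), l, (agree R xty lty x l).
  split=> //; first exact: free_in_agree.
  + exact: terminates_fair_assign.
  (* The witnesses are swapped: [other_value] for the updated valuation, the default value for the
     initial one. Both indicators are 1. *)
  + rewrite sat_box_set_other /sem !indicE !mem_set /=; first by lra.
    * rewrite /Exists satN satF => /(_ (other_value R (lty l)) Logic.I).
      by rewrite satN sat_agree update_same !other_value_neq; apply.
    * rewrite /Exists satN satF => /(_ (default_value R (lty l)) Logic.I).
      by rewrite satN sat_agree !eqxx; apply.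
  (* Each single instance would require [1 <= 1/2]. *)
  + rewrite /Exists satN satF; apply => v _.
    by rewrite satN /= sat_box_agree /=; lra.
Qed.
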